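(* Let $\mu$ be a $(C,\gamma)$-absolutely decaying measure on $\mathbb{R}$, let $K=\operatorname{supp}\mu$, and let $\alpha$ satisfy $$0<\alpha \le \frac14\left( \frac{1}{3C} \right)^{1/\gamma}.$$ Then for every bi-Lipschitz map $\varphi:\mathbb{R}\to\mathbb{R}$, every sequence $\mathcal Y=(y_n)_{n\in\mathbb{N}}$ of points of $\mathbb{T}=\mathbb{R}/\mathbb{Z}$, and every lacunary sequence $\mathcal T=(t_n)_{n\in\mathbb{N}}$ of positive reals, the set $\varphi\big(\tilde E(\mathcal T,\mathcal Y)\big)$ is $\alpha$-winning on $K$.
   Context: Balls are closed: $B(x,\rho)=\{z: d(x,z)\le\rho\}$. A locally finite Borel measure $\mu$ on $\mathbb{R}$ is $(C,\gamma)$-absolutely decaying ($C,\gamma>0$) if there is $\rho_0>0$ such that for all $0<\rho\le\rho_0$, all $x\in\operatorname{supp}\mu$, all $y\in\mathbb{R}$ and all $\varepsilon>0$: $\mu(B(x,\rho)\cap B(y,\varepsilon\rho))<C\varepsilon^\gamma\mu(B(x,\rho))$. A sequence $(t_n)$ of positive reals is lacunary if $\inf_n t_{n+1}/t_n>1$. With $\pi:\mathbb{R}\to\mathbb{T}$ the projection $x\mapsto x \bmod 1$ and $d$ the usual distance on $\mathbb{T}$, $\tilde E(\mathcal T,\mathcal Y)=\{x\in\mathbb{R}: \inf_{n\in\mathbb{N}} d(\pi(t_nx),y_n)>0\}$. A map $\varphi$ is bi-Lipschitz if there is $L\ge1$ with $L^{-1}\le|\varphi(x)-\varphi(y)|/|x-y|\le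 L$ for all $x\ne y$. Schmidt's game on a complete metric space $(X,d)$ with parameters $0<\alpha,\beta<1$ and target set $S\subset X$: on $\Omega=X\times\mathbb{R}_+$ write $(x_2,\rho_2)\le_s(x_1,\rho_1)$ if $\rho_2+d(x_1,x_2)\le\rho_1$. Bob picks $\omega_1=(x_1,\rho_1)$; then Alice and Bob alternately pick $\omega_k'=(x_k',\rho_k')\le_s\omega_k$ with $\rho_k'=\alpha\rho_k$ and $\omega_{k+1}=(x_{k+1},\rho_{k+1})\le_s\omega_k'$ with $\rho_{k+1}=\beta\rho_k'$. The nested balls $B(\omega_k)$ intersect in a single point $x_\infty$; Alice wins if $x_\infty\in S$. $S$ is $(\alpha,\beta)$-winning if Alice has a strategy that wins against every play of Bob, and $\alpha$-winning if it is $(\alpha,\beta)$-winning for every $\beta\in(0,1)$. For a closed $K\subset\mathbb{R}$, a set $S\subset\mathbb{R}$ is $\alpha$-winning on $K$ if $S\cap K$ is $\alpha$-winning for the game played on the metric space $K$ with the metric induced from $\mathbb{R}$ (i.e. all centers must lie in $K$). *)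

(* Defs.v *)
From HB Require Import structures.
From mathcomp Require Import all_boot all_order all_algebra.
From mathcomp Require Import all_classical all_reals all_analysis.
Set Implicit Arguments. Unset Strict Implicit. Unset Printing Implicit Defensive.
Import Order.TTheory GRing.Theory Num.Theory.
Import numFieldNormedType.Exports.
Local Open Scope classical_set_scope.
Local Open Scope ring_scope.

Definition cball {R : realType} (x rho : R) : set R := [set z | `|x - z| <= rho].

Definition supp {R : realType} (mu : {measure set (measurableTypeR R) -> \bar R}) : set R :=
  [set x | forall r : R, 0 < r -> (0 < mu (ball x r))%E].

Definition locally_finite {R : realType} (mu : {measure set (measurableTypeR R) -> \bar R}) :=
  forall x : R, exists2 r : R, 0 < r & (mu (ball x r) < +oo)%E.

Definition abs_decaying {R : realType} (mu : {measure set (measurableTypeR R) -> \bar R})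
    (C gamma : R) :=
  exists2 rho0 : R, 0 < rho0 &
    forall (rho x y eps : R), 0 < rho -> rho <= rho0 -> supp mu x -> 0 < eps ->
      (mu (cball x rho `&` cball y (eps * rho)) <
       (C * powR eps gamma)%:E * mu (cball x rho))%E.

Definition lacunary {R : realType} (t : nat -> R) :=
  (forall n, 0 < t n) /\ exists2 q : R, 1 < q & forall n, q <= t n.+1 / t n.

(* distance on T = R/Z between pi(a) and pi(b): quotient metric *)
Definition distT {R : realType} (a b : R) : R :=
  inf [set `|a - b - k%:~R| | k in [set: int]].

(* tilde E(T, Y): points y_n of T given by real representatives *)
Definition Etilde {R : realType} (t y : nat -> R) : set R :=
  [set x | exists2 delta : R, 0 < delta & forall n, delta <= distT (t n * x) (y n)].

Definition bi_lipschitz {R : realType} (phi : R -> R) :=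
  exists2 L : R, 1 <= L & forall x y : R, x != y ->
    L^-1 <= `|phi x - phi y| / `|x - y| /\ `|phi x - phi y| / `|x - y| <= L.

(* a position omega = (center, radius) *)
Definition le_s {R : realType} (w2 w1 : R * R) := w2.2 + `|w1.1 - w2.1| <= w1.2.

Definition alice_ok {R : realType} (K : set R) (alpha : R) (b a : R * R) :=
  [/\ K a.1, a.2 = alpha * b.2 & le_s a b].

Definition bob_ok {R : realType} (K : set R) (beta : R) (a b' : R * R) :=
  [/\ K b'.1, b'.2 = beta * a.2 & le_s b' a].

(* Alice's strategy: sees Bob's moves omega_1..omega_k, answers omega_k' *)
Definition strategy (R : realType) := seq (R * R) -> R * R.

Definition amove {R : realType} (sigma : strategy R) (b : nat -> R * R) (k : nat) :=
  sigma (mkseq b k.+1).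

Definition legal_prefix {R : realType} (K : set R) (beta : R) (sigma : strategy R)
    (b : nat -> R * R) (k : nat) :=
  (K (b 0%N).1 /\ 0 < (b 0%N).2) /\
  forall j, (j < k)%N -> bob_ok K beta (amove sigma b j) (b j.+1).

Definition winning_strategy {R : realType} (K : set R) (alpha beta : R) (S : set R)
    (sigma : strategy R) :=
  (forall b k, legal_prefix K beta sigma b k -> alice_ok K alpha (b k) (amove sigma b k)) /\
  (forall b, (forall k, legal_prefix K beta sigma b k) ->
     forall z, K z -> (forall k, `|(b k).1 - z| <= (b k).2) -> S z).

Definition ab_winning_on {R : realType} (K : set R) (alpha beta : R) (S : set R) :=
  exists sigma : strategy R, winning_strategy K alpha beta (S `&` K) sigma.

Definition alpha_winning_on {R : realType} (K : set R) (alpha : R) (S : set R) :=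
  forall beta : R, 0 < beta -> beta < 1 -> ab_winning_on K alpha beta S.

(* Main.v *)
Require Import Defs.
From HB Require Import structures.
From mathcomp Require Import all_boot all_order all_algebra.
From mathcomp Require Import all_classical all_reals all_analysis.
From mathcomp Require Import ring lra.
Import Order.TTheory GRing.Theory Num.Theory.
Import numFieldNormedType.Exports.
Local Open Scope classical_set_scope.
Local Open Scope ring_scope.

(* For each n the points z to be avoided cluster around the centers
   p_{n,k} = phi ((y_n + k) / t_n), which are 1 / (L t_n)-separated in k, so a
   ball of radius rho with 4 L t_n rho < 1 meets essentially at most one of them.
   The decay of mu gives two points of K in B(x, (1 - alpha) rho) whose distance
   exceeds 4 alpha rho; a threatening center can only be close to one of them.
   Giving the threat n the weight (4 L t_n rho)^(- e), where e > 0 is such that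
   a full round multiplies the weight by 3/2, Alice moves to the point with the
   smaller total weight of threats. A round then maps the potential Phi to at most
   3/4 Phi + c, where c bounds the weight of the newly relevant n and is finite by
   lacunarity. So Phi stays bounded, and no n remains a threat once t_n rho has
   become small: every n is avoided at a scale comparable to 1 / t_n. *)

(** * The support and the decay condition *)

(** Each point outside the support lies in a null ball with rational center and radius, and there
    are only countably many such balls. *)
Lemma negligible_setC_supp (R : realType)
    (mu : {measure set (measurableTypeR R) -> \bar R}) :
  mu.-negligible (~` supp mu).
Proof.
pose F k : set (measurableTypeR R) :=
  if unpickle k is Some pq then
    let B := ball (ratr pq.1 : R) (ratr pq.2 : R) in
    if mu B == 0%E then B else set0
  else set0 : set (measurableTypeR R).
apply: (@negligibleS _ _ _ mu (\bigcup_k F k)); last first.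
  apply: negligible_bigcup => k; rewrite /F.
  case: (unpickle k : option (rat * rat)) => [pq|]; last exact: negligible_set0.
  case: eqP => [h|_]; last exact: negligible_set0.
  by apply/negligibleP => //; exact: measurable_realfun.measurable_ball.
move=> x /existsNP[r /not_implyP[r0 /negP]]; rewrite lt0e measure_ge0 andbT negbK.
move=> /eqP mu0.
have [p] : exists p : rat, ratr p \in `]x - r / 4, x + r / 4[.
  by apply: rat_in_itvoo; lra.
rewrite in_itv /= => /andP[p1 p2].
have [q] : exists q : rat, ratr q \in `]r / 4, r / 2[.
  by apply: rat_in_itvoo; lra.
rewrite in_itv /= => /andP[q1 q2].
have [k kE] : exists k, unpickle k = Some (p, q).
  by exists (pickle (p, q)); rewrite pickleK.
exists k => //; rewrite /F kE /=.
rewrite (_ : mu _ = 0%E) ?eqxx.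
  by rewrite /ball /= ltr_distlC; apply/andP; split; lra.
apply: (subset_measure0 _ _ _ mu0).
- exact: measurable_realfun.measurable_ball.
- exact: measurable_realfun.measurable_ball.
move=> z; rewrite /ball /= !ltr_distlC => /andP[z1 z2].
by apply/andP; split; lra.
Qed.

Lemma cballE (R : realType) (x r : R) : cball x r = `[x - r, x + r]%classic.
Proof.
by apply/seteqP; split => z; rewrite /cball /= in_itv /= ler_distlC.
Qed.

Lemma measurable_cball (R : realType) (x r : R) :
  measurable (cball x r : set (measurableTypeR R)).
Proof. by rewrite cballE; exact: measurable_itv. Qed.

(* An interval of length [4 alpha rho] does not carry all the mass of
   [cball x ((1 - alpha) rho)], so it cannot contain all its points of [supp mu]. *)
Lemma decaying_separated_points (R : realType)
    (mu : {measure set (measurableTypeR R) -> \bar R}) (C gamma alpha : R) :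
  0 < C -> 0 < gamma -> abs_decaying mu C gamma ->
  0 < alpha -> alpha <= 4^-1 * powR ((3 * C)^-1) gamma^-1 ->
  exists2 rho0 : R, 0 < rho0 & forall x rho : R, supp mu x -> 0 < rho <= rho0 ->
    exists z1 z2, [/\ supp mu z1, supp mu z2, `|x - z1| <= (1 - alpha) * rho,
      `|x - z2| <= (1 - alpha) * rho & 4 * alpha * rho < `|z1 - z2|].
Proof.
move=> C0 g0 [rho0 rho00 dec] a0 ale; exists rho0 => // x rho Kx /andP[r0 rle].
(* With [y = x] and [eps = 1] the two balls coincide, and the strict inequality forces [1 < C]; this
   yields [D <= 1] and [alpha <= 1 / 4] below. *)
have C1 : 1 < C.
  rewrite ltNge; apply/negP => C1.
  have := dec _ _ x 1 r0 rle Kx ltr01; rewrite mul1r setIid powR1 mulr1 ltNge.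
  move/negP; apply; rewrite -[leRHS]mul1e; apply: lee_wpmul2r => //.
set D := powR (3 * C)^-1 gamma^-1 in ale.
have C3 : 0 <= (3 * C)^-1 by rewrite invr_ge0; lra.
have Dg : powR D gamma = (3 * C)^-1.
  by rewrite /D -powRrM mulVf ?gt_eqF// powRr1.
have D1 : D <= 1.
  have e1 : powR 1 gamma^-1 = 1 :> R by rewrite powR1.
  rewrite -[leRHS]e1; apply: ge0_ler_powR; rewrite ?nnegrE ?invr_ge0 ?(ltW g0) //.
    by rewrite mulr_ge0 ?(ltW C0).
  by rewrite invf_le1 ?mulr_gt0 //; lra.
have a4 : alpha <= 1 / 4 by lra.
set rho' := (1 - alpha) * rho.
have r'0 : 0 < rho' by rewrite mulr_gt0//; lra.
have r'le : rho' <= rho0 by rewrite /rho'; nra.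
apply: contrapT => no.
pose A := supp mu `&` cball x rho'.
have Ax : A x by split=> //; rewrite /cball /= subrr normr0 ltW.
have close z1 z2 : A z1 -> A z2 -> `|z1 - z2| <= 4 * alpha * rho.
  move=> [K1 B1] [K2 B2]; rewrite leNgt; apply/negP => h.
  by apply: no; exists z1, z2.
have Alb : has_lbound A.
  by exists (x - rho') => z [_]; rewrite /cball /= ler_distlC => /andP[].
(* [cball y (eps * rho')] is the interval of length [4 * alpha * rho] that starts at [inf A]. *)
pose y := inf A + 2 * alpha * rho.
pose eps := 2 * alpha / (1 - alpha).
have eps0 : 0 < eps by rewrite divr_gt0; lra.
have epsr : eps * rho' = 2 * alpha * rho by rewrite /eps /rho'; field; lra.
have sub : A `<=` cball y (eps * rho').
  move=> z Az; rewrite /cball /= epsr ler_distlC.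
  have := ge_inf Alb Az.
  have : z - 4 * alpha * rho <= inf A.
    apply: lb_le_inf; first by exists x.
    by move=> u Au; have := close _ _ Az Au; rewrite ler_norml => /andP[]; lra.
  by rewrite /y => h1 h2; apply/andP; split; lra.
have := dec _ _ y eps r'0 r'le Kx eps0; rewrite ltNge => /negP; apply.
have mle : (mu (cball x rho') <= mu (cball x rho' `&` cball y (eps * rho')))%E.
  have [N [mN N0 sN]] := negligible_setC_supp _ mu.
  have mI : measurable (cball x rho' `&` cball y (eps * rho') : set (measurableTypeR R)).
    by apply: measurableI; exact: measurable_cball.
  rewrite -(measureU0 mI mN N0); apply: le_measure; rewrite ?inE.
  - exact: measurable_cball.
  - exact: measurableU.
  move=> z Bz; have [Kz|nKz] := pselect (supp mu z).
    by left; split => //; apply: sub.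
  by right; apply: sN.
apply: le_trans mle; rewrite -[leRHS]mul1e; apply: lee_wpmul2r => //.
rewrite lee_fin.
(* From [alpha <= D / 4] and [1 - alpha >= 3 / 4] one gets [eps <= D], so the decay factor is at
   most [1 / 3]. *)
have : powR eps gamma <= (3 * C)^-1.
  rewrite -Dg; apply: ge0_ler_powR; rewrite ?nnegrE ?powR_ge0 ?(ltW g0) ?(ltW eps0)//.
  by rewrite /eps ler_pdivrMr; [nra|lra].
move=> /(ler_wpM2l (ltW C0)) /le_trans -> //.
by rewrite invfM mulrCA divff ?gt_eqF// mulr1; lra.
Qed.

(** * Bi-Lipschitz maps of the line *)

Lemma bi_lipschitz_ge (R : realType) (phi : R -> R) : bi_lipschitz phi ->
  exists2 L : R, 1 <= L & forall x y,
   `|x - y| <= L * `|phi x - phi y| /\ `|phi x - phi y| <= L * `|x - y|.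
Proof.
move=> [L L1 H]; exists L => // x y.
have [->|xy] := eqVneq x y; first by rewrite !subrr !normr0 mulr0.
have d0 : 0 < `|x - y| by rewrite normr_gt0 subr_eq0.
have L0 : 0 < L by lra.
have [] := H _ _ xy; rewrite ler_pdivrMr// ler_pdivlMr// => h1 h2.
by split=> //; rewrite -ler_pdivrMl.
Qed.

(** Used to pull the outcome of the game back through [phi]. The map is continuous and injective,
    and its values at [r] and [- r] are at least as far from [phi 0] as [v] is. *)
Lemma bi_lipschitz_surj (R : realType) (phi : R -> R) : bi_lipschitz phi ->
  forall v, exists w, phi w = v.
Proof.
move=> /bi_lipschitz_ge[L L1 H] v.
have L0 : 0 < L by lra.
have inj a b : phi a = phi b -> a = b.
  move=> e; have [] := H a b; rewrite e subrr normr0 mulr0 normr_le0 subr_eq0.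
  by move=> /eqP.
have cphi a b : {within `[a, b], continuous phi}.
  apply: continuous_subspaceT => x; apply/cvgrPdist_le => e e0 /=.
  near=> z; apply: le_trans (H x z).2 _.
  rewrite -ler_pdivlMl// distrC; near: z; apply/nbhs_normP.
  exists (L^-1 * e) => /=; first by rewrite mulr_gt0 ?invr_gt0.
  by move=> z /= /ltW; rewrite distrC.
pose r := L * `|v - phi 0| + 1.
have r1 : 1 <= r by rewrite /r lerDr mulr_ge0// ltW.
have far s : `|s| = r -> `|v - phi 0| <= `|phi s - phi 0|.
  move=> sr; have [h _] := H s 0; move: h; rewrite subr0 sr /r => h.
  by rewrite -(ler_pM2l L0); lra.
have [f1 f2] : `|v - phi 0| <= `|phi r - phi 0| /\ `|v - phi 0| <= `|phi (- r) - phi 0|.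
  by split; apply: far; rewrite ?normrN ger0_norm//; lra.
have ivt a b u : a <= b -> (phi a <= u <= phi b) || (phi b <= u <= phi a) ->
    exists2 c, a <= c <= b & phi c = u.
  move=> ab h; have [|c] := IVT ab (cphi a b) (v := u).
    by rewrite /Num.min /Num.max; case: ltP => ?; case/orP: h => /andP[? ?]; apply/andP; split; lra.
  by rewrite in_itv /= => hc e; exists c.
(* If [phi (- r)] lay between [phi 0] and [phi r], it would be attained again between [0] and [r],
   against injectivity. Together with [nl] this puts the two end values on opposite sides of
   [phi 0], with [v] between them. *)
have nr : ~~ ((phi 0 <= phi (- r) <= phi r) || (phi r <= phi (- r) <= phi 0)).
  by apply/negP => h; have [|c /andP[c0 _] /inj ce] := ivt 0 r (phi (- r)) _ h; lra.
have nl : ~~ ((phi (- r) <= phi r <= phi 0) || (phi 0 <= phi r <= phi (- r))).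
  by apply/negP => h; have [|c /andP[_ c0] /inj ce] := ivt (- r) 0 (phi r) _ h; lra.
suff [c _ e] : exists2 c, - r <= c <= r & phi c = v by exists c.
apply: ivt; first lra.
have := ler_norm (v - phi 0); have := ler_norm (phi 0 - v); rewrite (distrC (phi 0)).
move: f1 f2; case: (ler0P (phi r - phi 0)); case: (ler0P (phi (- r) - phi 0)); lra.
Unshelve. all: by end_near.
Qed.

(** * Lacunary sequences *)

(** Telescoping [s n <= (s n.+1 - s n) / (q - 1)] bounds the terms before [N] by [s N / (q - 1)].
    The bound is uniform in [N]. *)
Lemma geometric_partial_sum (R : realType) (s : nat -> R) (q B : R) :
  (forall n, 0 < s n) -> 1 < q -> (forall n, q * s n <= s n.+1) -> 0 < B ->
  forall N, \sum_(0 <= n < N | s n < B) s n <= q / (q - 1) * B.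
Proof.
move=> s0 q1 sq B0.
have sumlt N : \sum_(0 <= n < N) s n <= s N / (q - 1).
  elim: N => [|N IH]; first by rewrite big_geq// divr_ge0 ?ltW//; lra.
  rewrite big_nat_recr//=; move: IH; rewrite !ler_pdivlMr; [|lra|lra].
  by have := sq N; lra.
elim=> [|N IH].
  by rewrite big_geq// mulr_ge0 ?divr_ge0 ?(ltW B0)//; lra.
rewrite big_mkcond big_nat_recr//= -big_mkcond.
case: ltP => sN; last by rewrite addr0.
have le1 : \sum_(0 <= n < N | s n < B) s n <= s N / (q - 1).
  apply: le_trans (sumlt N); rewrite big_mkcond; apply: ler_sum => n _.
  by case: ifP => // _; rewrite ltW.
apply: le_trans (lerD le1 (lexx _)) _.
rewrite (_ : s N / (q - 1) + s N = q / (q - 1) * s N); last by field; lra.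
by rewrite ler_wpM2l ?(ltW sN)// divr_ge0; lra.
Qed.

(** Linear growth, as in Bernoulli's inequality, suffices. Hence only finitely many indices carry
    weight at a given scale. *)
Lemma lacunary_unbounded (R : realType) (s : nat -> R) (q B : R) :
  (forall n, 0 < s n) -> 1 < q -> (forall n, q * s n <= s n.+1) ->
  exists N, forall n, s n < B -> (n < N)%N.
Proof.
move=> s0 q1 sq.
have lin n : n%:R * ((q - 1) * s 0%N) + s 0%N <= s n.
  elim: n => [|n IH]; first by rewrite mul0r add0r.
  have := sq n; rewrite -natr1.
  have : 0 <= (q - 1) * (n%:R * ((q - 1) * s 0%N)).
    by rewrite !mulr_ge0// ?(ltW (s0 _))//; lra.
  nra.
have c0 : 0 < (q - 1) * s 0%N by rewrite mulr_gt0//; lra.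
exists (Num.bound (B / ((q - 1) * s 0%N))) => n sB.
rewrite ltnNge; apply/negP; rewrite -(ler_nat R) => le.
have := le_trans (ltW (unstable.ltr_bound (B / ((q - 1) * s 0%N)))) le.
rewrite ler_pdivrMr// => h.
by have := lin n; have := s0 0%N; lra.
Qed.

Lemma lacunary_ge_first (R : realType) (s : nat -> R) (q : R) :
  (forall n, 0 < s n) -> 1 < q -> (forall n, q * s n <= s n.+1) ->
  forall n, s 0%N <= s n.
Proof.
move=> s0 q1 sq; elim=> // n IH; apply: le_trans IH (le_trans _ (sq n)).
by rewrite ler_peMl ?ltW.
Qed.

Lemma big_nat_stable (R : realType) (P : pred nat) (F : nat -> R) (N0 N : nat) :
  (forall n, P n -> (n < N0)%N) -> (N0 <= N)%N ->
  \sum_(0 <= n < N | P n) F n = \sum_(0 <= n < N0 | P n) F n.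
Proof.
move=> PN le; rewrite (big_cat_nat (leq0n N0) le) /= [X in _ + X]big1_seq ?addr0//.
by move=> i /andP[/PN]; rewrite mem_index_iota ltnNge => /negbTE ->.
Qed.

(* [w] is the power [u |-> u ^ e] whose negative exponent [e] satisfies
   [m ^ e = 3 / 2]; any factor in ]1, 2[ would do. *)
Lemma weight_exists (R : realType) (m : R) : 0 < m < 1 ->
  exists w : R -> R, [/\ forall u, 0 < w u,
    forall u, 0 < u -> w (m * u) = 3 / 2 * w u,
    forall u, 1 <= u -> w u <= 1 &
    forall M, 0 < M -> exists2 kappa, 0 < kappa &
      forall u, 0 < u -> w u <= M -> kappa <= u].
Proof.
move=> /andP[m0 m1].
have lm : ln m < 0 by apply: ln_lt0; rewrite m0.
have l32 : 0 < ln (3 / 2 : R) by apply: ln_gt0; lra.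
pose e := ln (3 / 2) / ln m.
have e0 : e < 0 by rewrite /e pmulr_rlt0// invr_lt0.
exists (fun u => expR (e * ln u)); split.
- by move=> u; exact: expR_gt0.
- move=> u u0; rewrite lnM// mulrDr expRD; congr (_ * _).
  by rewrite /e divfK ?lt_eqF// lnK// posrE; lra.
- by move=> u u1; rewrite -expR0 ler_expR nmulr_rle0// ln_ge0.
- move=> M M0; exists (expR (ln M / e)); first exact: expR_gt0.
  move=> u u0; rewrite -{1}(lnK M0) ler_expR => h.
  by rewrite -[leRHS](lnK u0) ler_expR ler_ndivrMr// mulrC.
Qed.

(** * The game and its potential *)

(** The measure and the map enter only through the separated pairs in [K] and the spacing of the
    centers [p n k]. *)
Lemma potential_winning (R : realType) (K S : set R) (alpha beta rho0 q : R)
    (s : nat -> R) (p : nat -> int -> R) :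
  0 < alpha -> 0 < beta -> beta < 1 -> 0 < rho0 ->
  (forall x rho : R, K x -> 0 < rho <= rho0 ->
    exists z1 z2, [/\ K z1, K z2, `|x - z1| <= (1 - alpha) * rho,
      `|x - z2| <= (1 - alpha) * rho & 4 * alpha * rho < `|z1 - z2|]) ->
  (forall n, 0 < s n) -> 1 < q -> (forall n, q * s n <= s n.+1) ->
  (forall n k l, k != l -> 4 <= s n * `|p n k - p n l|) ->
  (forall z, K z -> (exists2 delta, 0 < delta &
     forall n k, delta <= s n * `|z - p n k|) -> S z) ->
  ab_winning_on K alpha beta S.
Proof.
move=> a0 b0 b1 rho00 sepK s0 q1 sq sepp SP.
have a1 x : K x -> alpha <= 1.
  move=> Kx; have [|z1 [_ [_ _ h _ _]]] := sepK x rho0 Kx; first by rewrite rho00 lexx.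
  have := le_trans (normr_ge0 _) h; rewrite pmulr_lge0//; lra.
pose m : R := alpha * beta.
have m0 : 0 < m by rewrite mulr_gt0.
have ma : m < alpha by rewrite /m gtr_pMr.
have [->|/set0P[xK KxK]] := eqVneq K set0.
  exists (fun=> (0, 0)); split; first by move=> b k [[]].
  by move=> b H z [].
have m1 : m < 1 by have := a1 _ KxK; lra.
have [|w [w0 wm w1 wK]] := @weight_exists _ m; first by rewrite m0.
(* [near_p x (2 * rho) n]: the index [n] is still a threat in Bob's ball. *)
pose near_p (x r : R) n := `[< exists k, `|p n k - x| <= r >].
(* [rho] sets the weights and [r] the reach, because Alice's smaller ball is still weighed at Bob's
   scale. The sum is eventually constant in [N], so statements for [N] near infinity replace an
   infinite series. *)
pose Phi (x rho r : R) N :=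
  \sum_(0 <= n < N) if (s n * rho < 1) && near_p x r n then w (s n * rho) else 0.
have Phi_stable (rho : R) : 0 < rho -> exists N0, forall x r N, (N0 <= N)%N ->
    Phi x rho r N = Phi x rho r N0.
  move=> r0; have [N0 hN0] := lacunary_unbounded _ s q rho^-1 s0 q1 sq.
  exists N0 => x r N le; rewrite /Phi -!big_mkcond; apply: big_nat_stable => // n.
  move=> /andP[h _]; apply: hN0.
  by rewrite -[rho^-1]mul1r ltr_pdivlMr.
pose good (b : R * R) x' := [/\ K x', `|b.1 - x'| <= (1 - alpha) * b.2 &
  b.2 <= rho0 -> \forall N \near \oo,
    2 * Phi x' b.2 (2 * alpha * b.2) N <= Phi b.1 b.2 (2 * b.2) N].
have ex_good b : exists x', K b.1 -> 0 < b.2 -> good b x'.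
  have [Kx|] := pselect (K b.1); last by exists 0.
  have [r0|r0] := ltP 0 b.2; last by exists 0.
  have [rle|rgt] := leP b.2 rho0; last first.
    exists b.1 => _ _; split => //; last by rewrite leNgt rgt.
    by rewrite subrr normr0 mulr_ge0 ?(ltW r0)// subr_ge0 (a1 _ Kx).
  have [|z1 [z2 [K1 K2 d1 d2 d12]]] := sepK b.1 b.2 Kx; first by rewrite r0.
  have [N0 hN0] := Phi_stable _ r0.
  have hit x' : `|b.1 - x'| <= (1 - alpha) * b.2 ->
      forall n, near_p x' (2 * alpha * b.2) n -> exists2 k,
       `|p n k - x'| <= 2 * alpha * b.2 & `|p n k - b.1| <= 2 * b.2.
    move=> dx' n /asboolP[k hk]; exists k => //.
    have := ler_distD x' (p n k) b.1; rewrite (distrC x').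
    have := a1 _ Kx; nra.
  (* A common center would bring [z1] and [z2] within [4 * alpha * b.2]; two distinct centers would
     be at most [4 * b.2] apart, against the spacing. *)
  have disj n : s n * b.2 < 1 -> near_p z1 (2 * alpha * b.2) n ->
      near_p z2 (2 * alpha * b.2) n -> False.
    move=> act /(hit _ d1)[k1 h1 h1'] /(hit _ d2)[k2 h2 h2'].
    have [e|/(sepp n)] := eqVneq k1 k2.
      have := ler_distD (p n k1) z1 z2; rewrite (distrC z1 (p n k1)).
      by move: h2; rewrite -e; lra.
    have := ler_distD b.1 (p n k1) (p n k2); rewrite (distrC b.1) => h4.
    have : s n * `|p n k1 - p n k2| <= s n * (4 * b.2) by rewrite ler_wpM2l ?(ltW (s0 n))//; lra.
    lra.
  have sum12 : Phi z1 b.2 (2 * alpha * b.2) N0 + Phi z2 b.2 (2 * alpha * b.2) N0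
      <= Phi b.1 b.2 (2 * b.2) N0.
    rewrite /Phi -big_split /=; apply: ler_sum => n _.
    have [act|] /= := ltP (s n * b.2) 1; last by rewrite addr0.
    have wn := w0 (s n * b.2).
    case: (boolP (near_p z1 _ n)) => h1; case: (boolP (near_p z2 _ n)) => h2.
    - by case: (disj n).
    - have [k _ hk] := hit _ d1 _ h1.
      by rewrite addr0 ifT//; apply/asboolP; exists k.
    - have [k _ hk] := hit _ d2 _ h2.
      by rewrite add0r ifT//; apply/asboolP; exists k.
    - by rewrite addr0; case: ifP => // _; rewrite ltW.
  have [le|lt] := leP (Phi z1 b.2 (2 * alpha * b.2) N0) (Phi z2 b.2 (2 * alpha * b.2) N0).
    exists z1 => _ _; split=> // _; exists N0 => //= N /= N0N.
    by rewrite !(hN0 _ _ N)//; lra.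
  exists z2 => _ _; split=> // _; exists N0 => //= N /= N0N.
  by rewrite !(hN0 _ _ N)//; lra.
have [f fP] := choice ex_good.
(* A newly relevant [n] has [1 <= s n * b.2], so its weight is at most
   [3 / 2 <= 3 / 2 * (s n * b.2)]; these terms are summed over [s n < (m * b.2)^-1]. *)
pose c := 3 / 2 * (q / (q - 1) * m^-1).
have c0 : 0 < c by rewrite !mulr_gt0 ?invr_gt0//; lra.
have step b y : K b.1 -> 0 < b.2 <= rho0 ->
    m * b.2 + `|f b - y| <= alpha * b.2 ->
    \forall N \near \oo, Phi y (m * b.2) (2 * (m * b.2)) N <=
      3 / 4 * Phi b.1 b.2 (2 * b.2) N + c.
  move=> Kx /andP[r0 rle] dy; have [Kf df /(_ rle) half] := fP b Kx r0.
  apply: filterS half => N half.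
  suff : Phi y (m * b.2) (2 * (m * b.2)) N <=
      3 / 2 * Phi (f b) b.2 (2 * alpha * b.2) N + c by lra.
  have cle : 3 / 2 * (\sum_(0 <= n < N | s n < (m * b.2)^-1) s n * b.2) <= c.
    rewrite /c ler_pM2l; last lra.
    rewrite -mulr_suml -ler_pdivlMr//.
    apply: le_trans (geometric_partial_sum _ s q (m * b.2)^-1 s0 q1 sq _ N) _.
      by rewrite invr_gt0 mulr_gt0.
    by rewrite invfM !mulrA.
  apply: le_trans (lerD (lexx _) cle).
  rewrite [X in _ + _ * X]big_mkcond /Phi !mulr_sumr -big_split /=; apply: ler_sum => n _.
  have sb : 0 < s n * b.2 by rewrite mulr_gt0.
  have wn := w0 (s n * b.2).
  have -> : (s n < (m * b.2)^-1) = (s n * (m * b.2) < 1).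
    by rewrite -[(m * _)^-1]mul1r ltr_pdivlMr// mulr_gt0.
  have [act'|_] /= := ltP (s n * (m * b.2)) 1; last first.
    by rewrite mulr0 addr0; case: ifP => // _; lra.
  have [/asboolP[k hk]|_] := boolP (near_p y _ n); last by case: ifP => _; nra.
  rewrite mulrCA wm//.
  have [act|nact] /= := ltP (s n * b.2) 1.
    rewrite ifT; first lra.
    apply/asboolP; exists k.
    (* The distance to [f b] is at most [(m + alpha) * b.2], and [m < alpha]. *)
    have := ler_distD y (p n k) (f b); rewrite (distrC y); nra.
  by have := w1 _ nact; lra.
(* Only Bob's last move matters; the histories in play are nonempty, so the default [(0, 0)] is
   never read. *)
exists (fun h => (f (last (0, 0) h), alpha * (last (0, 0) h).2)).
set sigma := (fun h => _).
have amoveE b k : amove sigma b k = (f (b k), alpha * (b k).2).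
  by rewrite /amove /sigma mkseqS last_rcons.
have legalP b k : legal_prefix K beta sigma b k -> K (b k).1 /\ 0 < (b k).2.
  move=> [[K0 r0]]; case: k => [//|k] H.
  elim: k.+1 H => // j IH H; have [] := IH (fun i ij => H i (leqW ij)).
  have [] := H j (ltnSn _); rewrite amoveE /= => Kj -> _ _ r.
  by split=> //; rewrite !mulr_gt0.
split=> [b k /legalP[Kb rb]|b H z Kz zB].
  rewrite amoveE; have [Kf df _] := fP _ Kb rb; split=> //=.
  by rewrite /le_s /=; lra.
split=> //; apply: SP => //.
have Kb k : K (b k).1 by have [] := legalP _ _ (H k).
have rb k : 0 < (b k).2 by have [] := legalP _ _ (H k).
have mv k : (b k.+1).2 = m * (b k).2 /\ m * (b k).2 + `|f (b k) - (b k.+1).1| <= alpha * (b k).2.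
  have [_ /(_ k (ltnSn k))] := H k.+1; rewrite amoveE => -[_ e] /=; rewrite /le_s /= e /=.
  by rewrite !mulrA (mulrC beta).
have rE k : (b k).2 = m ^+ k * (b 0%N).2.
  by elim: k => [|k IH]; rewrite ?expr0 ?mul1r// (mv k).1 IH exprS mulrA.
have rsmall e : 0 < e -> exists k, (b k).2 < e.
  move=> e0.
  have [|N _ hN] := (cvgrPdist_lt _ _).1 (@cvg_expr R m _) (e / (b 0%N).2) (divr_gt0 e0 (rb 0%N)).
    by rewrite ger0_norm// ltW.
  have := hN N (leqnn N); rewrite /= sub0r normrN ger0_norm ?exprn_ge0 ?ltW//.
  by rewrite ltr_pdivlMr// -rE => h; exists N.
have rmono k : (b k.+1).2 <= (b k).2.
  by rewrite (mv k).1 ger_pMl// ltW.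
have radd j k : (b (j + k)%N).2 <= (b k).2.
  by elim: j => [|j IH]; rewrite ?add0n// addSn (le_trans (rmono _)).
(* Decay is available only below [rho0], so the potential is followed from round [j0] on. *)
have [j0 j0P] := rsmall _ rho00.
have rle k : (b (j0 + k)%N).2 <= rho0.
  by rewrite addnC (le_trans (radd _ _))// ltW.
have [N0 hN0] := Phi_stable _ (rb j0).
(* [4 * c <= M] makes [M] stable under the map [3 / 4 * M + c]. *)
pose M := Num.max (Phi (b j0).1 (b j0).2 (2 * (b j0).2) N0) (4 * c).
have M0 : 0 < M by rewrite lt_max; apply/orP; right; lra.
have bnd k : let x := b (j0 + k)%N in
    \forall N \near \oo, Phi x.1 x.2 (2 * x.2) N <= M.
  elim: k => [|k IH] /=.
    by rewrite addn0; exists N0 => //= N /= N0N; rewrite hN0// le_max lexx.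
  rewrite addnS; have [-> h] := mv (j0 + k)%N.
  have := step _ _ (Kb _) _ h; rewrite rb rle => /(_ isT) h'.
  apply: filterS2 IH h' => N h1 h2; apply: (le_trans h2).
  have : 4 * c <= M by rewrite le_max lexx orbT.
  by lra.
have [kappa kap0 kapP] := wK _ M0.
pose kap := Num.min kappa 1.
have kap'0 : 0 < kap by rewrite lt_min kap0 ltr01.
(* A remaining threat [n] would contribute its whole weight to a sum bounded by [M], forcing
   [kappa <= s n * rho]; the minimum with [1] ensures that its term is counted. *)
have safe n k i : s n * (b (j0 + k)%N).2 < kap -> (b (j0 + k)%N).2 < `|z - p n i|.
  rewrite lt_min => /andP[lt1 lt2]; set x := b (j0 + k)%N in lt1 lt2 *.
  have far : ~~ near_p x.1 (2 * x.2) n.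
    apply/negP => al; move: lt1; rewrite ltNge => /negP; apply.
    apply: kapP; first exact: mulr_gt0 (s0 n) (rb _).
    have [N1 _ hN1] := bnd k; have := hN1 (maxn N1 n.+1) (leq_maxl _ _).
    apply: le_trans; rewrite -/x /Phi.
    rewrite (bigD1_seq n) ?mem_index_iota ?iota_uniq//=; last exact: leq_maxr.
    rewrite lt2 al /= lerDl; apply: sumr_ge0 => j _.
    by case: ifP => // _; rewrite ltW.
  have : ~ (`|p n i - x.1| <= 2 * x.2).
    by move=> h; move/negP: far; apply; apply/asboolP; exists i.
  move=> /negP; rewrite -ltNge.
  have := ler_distD z (p n i) x.1; rewrite (distrC (p n i) z) (distrC z x.1).
  by have := zB (j0 + k)%N; rewrite -/x; lra.
(* At the first round with [s n * rho < kap], either the previous product was at least [kap] and has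
   shrunk by [m], or the round is [j0] itself and [s 0 <= s n] applies. *)
exists (Num.min (m * kap) (s 0%N * (b j0).2)).
  by rewrite lt_min !mulr_gt0.
move=> n i.
have ex : exists k, s n * (b (j0 + k)%N).2 < kap.
  have [k hk] := rsmall (kap / s n) (divr_gt0 kap'0 (s0 n)).
  exists k; rewrite mulrC -ltr_pdivlMr//; apply: le_lt_trans hk.
  exact: radd.
case: (ex_minnP ex) => k hk kmin.
apply: le_trans (_ : s n * (b (j0 + k)%N).2 <= _); last first.
  by rewrite ler_wpM2l ?(ltW (safe _ _ _ hk))// ltW.
case: k hk kmin => [|k] hk kmin.
  rewrite addn0 ge_min; apply/orP; right; rewrite ler_wpM2r ?(ltW (rb _))//.
  exact: lacunary_ge_first _ _ _ s0 q1 sq n.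
rewrite ge_min; apply/orP; left; rewrite addnS (mv _).1 mulrCA ler_wpM2l ?(ltW m0)//.
by rewrite leNgt; apply/negP => /kmin; rewrite ltnn.
Qed.

(** * Application to [Etilde] *)

Theorem theorem1p1 (R : realType) (mu : {measure set (measurableTypeR R) -> \bar R})
    (C gamma alpha : R) :
  0 < C -> 0 < gamma -> locally_finite mu -> abs_decaying mu C gamma ->
  0 < alpha -> alpha <= 4^-1 * powR ((3 * C)^-1) gamma^-1 ->
  forall (phi : R -> R) (y t : nat -> R),
    bi_lipschitz phi -> lacunary t ->
    alpha_winning_on (supp mu) alpha (phi @` Etilde t y).
Proof.
move=> C0 g0 _ dec a0 ale phi y t bl [t0 [q q1 tq]] beta b0 b1.
have [rho0 rho00 sep] := decaying_separated_points _ _ _ _ _ C0 g0 dec a0 ale.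
have surj := bi_lipschitz_surj _ _ bl.
have [L L1 H] := bi_lipschitz_ge _ _ bl.
have L0 : 0 < L by lra.
pose s n : R := 4 * L * t n.
pose p n (k : int) := phi ((y n + k%:~R) / t n).
have key n k x : t n * x - y n - k%:~R = t n * (x - (y n + k%:~R) / t n).
  by have := t0 n => tn; field; lra.
have sgt0 n : 0 < s n by rewrite /s !mulr_gt0.
have sq n : q * s n <= s n.+1.
  by have := tq n; rewrite /s ler_pdivlMr// mulrCA => h; rewrite ler_wpM2l//; lra.
have spacing n k l : k != l -> 4 <= s n * `|p n k - p n l|.
  move=> kl; have [h _] := H ((y n + k%:~R) / t n) ((y n + l%:~R) / t n).
  rewrite -/(p n k) -/(p n l) in h.
  have : 1 <= `|k%:~R - l%:~R : R|.
    by rewrite -intrB -intr_norm (ler_int R 1) -gtz0_ge1 normr_gt0 subr_eq0.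
  have -> : k%:~R - l%:~R = t n * ((y n + k%:~R) / t n - (y n + l%:~R) / t n) :> R.
    by have := t0 n => tn; field; lra.
  rewrite normrM gtr0_norm// => h1.
  have := ler_wpM2l (ltW (t0 n)) h; rewrite /s; lra.
apply: (potential_winning _ _ _ _ _ rho0 q s p) => //.
move=> z Kz [delta d0 hd].
have [w we] := surj z; exists w => //.
(* One factor [L] comes from [s], the other from the upper Lipschitz bound of [phi]. *)
exists (delta / (4 * L ^+ 2)); first by rewrite divr_gt0// mulr_gt0// exprn_gt0.
move=> n; apply: lb_le_inf; first by exists `|t n * w - y n - 0%:~R|, 0.
move=> _ [k _ <-]; rewrite key normrM (gtr0_norm (t0 n)).
have [_ h] := H w ((y n + k%:~R) / t n).
have := hd n k; rewrite ler_pdivrMr ?mulr_gt0 ?exprn_gt0//.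
move=> /le_trans; apply; rewrite -we /s.
have := ler_wpM2l (ltW (sgt0 n)) h; rewrite /s => /le_trans; apply.
by rewrite le_eqVlt; apply/orP; left; apply/eqP; ring.
Qed.
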